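(* Let $G$ be a groupoid, let $A$ be a ring and let $\sigma=(A_g,\sigma_g)_{g\in G}$ be a partial action of $G$ on $A$ such that $A_g$ is $s$-unital for every $g\in G$ and $A=\oplus_{e\in G_0}A_e$. Let $G_0':=\{e\in G_0: A_e\neq\{0\}\}$. Then the following statements are equivalent: (i) the partial skew groupoid ring $A\rtimes_\sigma G$ is prime; (ii) $A$ is $G$-prime and, for every $e\in G_0'$, $A_e\rtimes_{\sigma^e}G_e^e$ is prime; (iii) $A$ is $G$-prime and, for some $e\in G_0'$, $A_e\rtimes_{\sigma^e}G_e^e$ is prime; (iv) $A\rtimes_\sigma G$ is graded prime and, for every $e\in G_0'$, $A_e\rtimes_{\sigma^e}G_e^e$ is prime; (v) $A\rtimes_\sigma G$ is graded prime and, for some $e\in G_0'$, $A_e\rtimes_{\sigma^e}G_e^e$ is prime; (vi) for every $e\in G_0'$, $e$ is a support-hub and $A_e\rtimes_{\sigma^e}G_e^e$ is prime; (vii) for some $e\in G_0'$, $e$ is a support-hub and $A_e\rtimes_{\sigma^e}G_e^e$ is prime.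
   Context: All rings are associative but not necessarily unital; ideals are two-sided. For subsets $X,Y$ of a ring, $XY$ denotes the set of finite sums of products $xy$ with $x\in X$, $y\in Y$. A ring is prime if it has no nonzero ideals $I,J$ with $IJ=\{0\}$. A ring $R$ is $s$-unital if for every $x\in R$ there are $a,b\in R$ with $ax=x=xb$. A groupoid $G$ is a small category in which every morphism is invertible; $G$ also denotes its set of morphisms. Objects are identified with identity morphisms, so the set of objects $G_0$ is a subset of $G$. The maps $s,r:G\to G_0$ are source and range; $gh$ is defined iff $s(g)=r(h)$. For $e\in G_0$, $G_e^e:=\{g\in G: s(g)=r(g)=e\}$. A partial action of $G$ on a ring $A$ is a family $\sigma=(A_g,\sigma_g)_{g\in G}$ such that: (i) for each $g\in G$, $A_{r(g)}$ is an ideal of $A$, $A_g$ is an ideal of $A_{r(g)}$, and $\sigma_g:A_{g^{-1}}\to A_g$ is a ring isomorphism; (ii) $\sigma_e=\mathrm{id}_{A_e}$ for $e\in G_0$; (iii) $\sigma_h^{-1}(A_{g^{-1}}\cap A_h)\subseteq A_{(gh)^{-1}}$ whenever $s(g)=r(h)$; (iv) $\sigma_g(\sigma_h(x))=\sigma_{gh}(x)$ for all $x\in\sigma_h^{-1}(A_{g^{-1}}\cap A_h)$ whenever $s(g)=r(h)$. Here $A=\oplus_{e\in G_0}A_e$ means that $A$ is the internal direct sum of the ideals $A_e$. The partial skew groupoid ring $S=A\rtimes_\sigma G$ is the set of formal sums $\sum_{g\in G}a_g\delta_g$ with $a_g\in A_g$ zero for all but finitely many $g$, with pointwise addition and multiplication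 determined by $a_g\delta_g\cdot b_h\delta_h=\sigma_g(\sigma_{g^{-1}}(a_g)b_h)\delta_{gh}$ if $s(g)=r(h)$, and $0$ otherwise (it is associative under the hypotheses here). It is graded by $S_g:=A_g\delta_g$, $g\in G$. For $e\in G_0$, $\sigma^e:=(A_h,\sigma_h)_{h\in G_e^e}$ is the restricted partial action of the group $G_e^e$ on $A_e$, and $A_e\rtimes_{\sigma^e}G_e^e$ is the associated partial skew group ring. An ideal $I$ of $A$ is $G$-invariant if $\sigma_g(I\cap A_{g^{-1}})\subseteq I$ for every $g\in G$; $A$ is $G$-prime if there are no nonzero $G$-invariant ideals $I,J$ of $A$ with $IJ=\{0\}$. An ideal $I$ of $S$ is graded if $I=\oplus_{g\in G}(I\cap S_g)$; $S$ is graded prime if there are no nonzero graded ideals $I,J$ of $S$ with $IJ=\{0\}$. An element $e\in G_0'$ is a support-hub if for every $g\in G$ and every nonzero $a_g\delta_g\in A_g\delta_g$ there are $h,k\in G$ with $s(h)=e$, $r(k)=e$ such that $a_g\delta_gA_h\delta_h$ and $A_k\delta_ka_g\delta_g$ are both nonzero.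
   Formalization: The formal theorem also assumes A ≠ {0}; for A = {0} the set G_0' is empty, so (i), (ii), (iv), (vi) hold while (iii), (v), (vii) fail and the stated equivalence is false. *)

(* Defs.v *)
From HB Require Import structures.
From mathcomp Require Import all_boot all_order all_algebra finmap.
From mathcomp Require Import boolp classical_sets functions cardinality fsbigop.

Set Implicit Arguments.
Unset Strict Implicit.
Unset Printing Implicit Defensive.

Import GRing.Theory.

Local Open Scope classical_set_scope.
Local Open Scope ring_scope.

(* MathComp has no rings without unit.  A [naRingType] has a biadditive product
   that is not required to be associative, a [nuRingType] is an associative,
   not necessarily unital, ring.  Ideals and primeness only need the former, so
   they make sense for partial skew groupoid rings, whose associativity is a
   theorem that depends on hypotheses on the coefficient ring. *)

HB.mixin Record Zmodule_isNARing R of GRing.Zmodule R := {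
  rmul : R -> R -> R;
  rmulDl : left_distributive rmul +%R;
  rmulDr : right_distributive rmul +%R
}.

#[short(type="naRingType")]
HB.structure Definition NARing := {R of Zmodule_isNARing R & GRing.Zmodule R}.

HB.mixin Record NARing_isNURing R of NARing R := {
  rmulA : associative (@rmul R)
}.

#[short(type="nuRingType")]
HB.structure Definition NURing := {R of NARing_isNURing R & NARing R}.

Notation "x ** y" := (rmul x y) (at level 40, left associativity) : ring_scope.

Section RmulTheory.
Variable R : naRingType.
Implicit Types x y : R.

Lemma rmul0 x : x ** 0 = 0.
Proof. by apply: (@addIr _ (x ** 0)); rewrite -rmulDr !add0r. Qed.

Lemma rmul0l x : 0 ** x = 0.
Proof. by apply: (@addIr _ (0 ** x)); rewrite -rmulDl !add0r. Qed.

End RmulTheory.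

Section Rings.
Variable R : naRingType.
Implicit Types X Y B I J : set R.

Definition set_mul X Y : set R :=
  [set z | exists2 s : seq (R * R),
     (forall p, p \in s -> X p.1 /\ Y p.2) & z = \sum_(p <- s) p.1 ** p.2].

Definition ideal_in B I : Prop :=
  [/\ I `<=` B, I 0, forall x y, I x -> I y -> I (x - y) &
      forall b x, B b -> I x -> I (b ** x) /\ I (x ** b)].

Definition ideal I : Prop := ideal_in [set: R] I.

Definition prime_for (P : set R -> Prop) : Prop :=
  ~ exists I J, [/\ P I, P J, I <> [set 0], J <> [set 0] &
                   set_mul I J = [set 0]].

Definition prime_ring : Prop := prime_for ideal.

Definition s_unital B : Prop :=
  forall x, B x -> exists a b, [/\ B a, B b, a ** x = x & x = x ** b].

End Rings.

Definition is_sum_decomposition (V : zmodType) (T : choiceType) (D : set T)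
    (F : T -> set V) (x : V) (f : T -> V) : Prop :=
  [/\ forall i, D i -> F i (f i), forall i, ~ D i -> f i = 0,
      finite_set [set i | f i != 0] & x = \sum_(i \in D) f i].

Definition internal_direct_sum (V : zmodType) (T : choiceType) (D : set T)
    (F : T -> set V) (X : set V) : Prop :=
  X = [set x | exists f, is_sum_decomposition D F x f] /\
  forall x f f', is_sum_decomposition D F x f ->
    is_sum_decomposition D F x f' -> f = f'.

(* The elements are the morphisms, and objects are identified with identity
   morphisms; [gmul g h] is only meaningful when [gsrc g = gtgt h]. *)
HB.mixin Record isGroupoid G of Choice G := {
  gsrc : G -> G;
  gtgt : G -> G;
  gmul : G -> G -> G;
  ginv : G -> G;
  gsrc_src : forall g, gsrc (gsrc g) = gsrc g;
  gtgt_src : forall g, gtgt (gsrc g) = gsrc g;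
  gsrc_tgt : forall g, gsrc (gtgt g) = gtgt g;
  gtgt_tgt : forall g, gtgt (gtgt g) = gtgt g;
  gsrcM : forall g h, gsrc g = gtgt h -> gsrc (gmul g h) = gsrc h;
  gtgtM : forall g h, gsrc g = gtgt h -> gtgt (gmul g h) = gtgt g;
  gmulA : forall g h k, gsrc g = gtgt h -> gsrc h = gtgt k ->
    gmul g (gmul h k) = gmul (gmul g h) k;
  gmul_src : forall g, gmul g (gsrc g) = g;
  gmul_tgt : forall g, gmul (gtgt g) g = g;
  gsrcV : forall g, gsrc (ginv g) = gtgt g;
  gtgtV : forall g, gtgt (ginv g) = gsrc g;
  gmulgV : forall g, gmul g (ginv g) = gtgt g;
  gmulVg : forall g, gmul (ginv g) g = gsrc g
}.

#[short(type="groupoidType")]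
HB.structure Definition Groupoid := {G of isGroupoid G & Choice G}.

Definition gobj (G : groupoidType) : set G := [set e | gsrc e = e].

Section GroupoidTheory.
Variable G : groupoidType.
Implicit Types g h : G.

Lemma gobj_tgt e : gobj e -> gtgt e = e :> G.
Proof. by move=> <-; rewrite gtgt_src. Qed.

Lemma gmulKV g h : gsrc g = gtgt h -> gmul (ginv g) (gmul g h) = h.
Proof.
by move=> gh; rewrite gmulA ?gsrcV// gmulVg gh gmul_tgt.
Qed.

Lemma gmulK g h : gsrc g = gtgt h -> gmul (gmul g h) (ginv h) = g.
Proof. by move=> gh; rewrite -gmulA ?gtgtV// gmulgV -gh gmul_src. Qed.

Lemma ginvK : involutive (@ginv G).
Proof.
move=> g; have := @gmulKV (ginv g) g; rewrite gsrcV => /(_ erefl).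
by rewrite gmulVg -{1}gtgtV -gsrcV gmul_src.
Qed.

Lemma ginvM g h : gsrc g = gtgt h -> ginv (gmul g h) = gmul (ginv h) (ginv g).
Proof.
move=> gh.
have hg : gsrc (ginv h) = gtgt (ginv g) by rewrite gsrcV gtgtV.
have e : gmul (gmul g h) (gmul (ginv h) (ginv g)) = gtgt g.
  rewrite gmulA//; last by rewrite gsrcM// gtgtV.
  by rewrite gmulK// gmulgV.
have := @gmulKV (gmul g h) (gmul (ginv h) (ginv g)).
rewrite gsrcM// gtgtM// gtgtV => /(_ erefl) <-; rewrite e.
by rewrite -(gtgtM _ _ gh) -gsrcV gmul_src.
Qed.

End GroupoidTheory.

(* The isotropy group [G_e^e] as a groupoid with the single object [e]. *)
Definition in_isotropy (G : groupoidType) (e : G) : pred G :=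
  fun g => (gsrc g == e) && (gtgt g == e).

Definition isotropy (G : groupoidType) (e : G) : Type :=
  {g : G | in_isotropy e g}.

Section Isotropy.
Variables (G : groupoidType) (e : G).

HB.instance Definition _ := SubChoice.copy (isotropy e)
  {g : G | in_isotropy e g}.

Implicit Types g h : isotropy e.

Lemma iso_src g : gsrc (val g) = e.
Proof. by case: g => g /= /andP[/eqP]. Qed.

Lemma iso_tgt g : gtgt (val g) = e.
Proof. by case: g => g /= /andP[_ /eqP]. Qed.

Lemma iso_comp g h : gsrc (val g) = gtgt (val h).
Proof. by rewrite iso_src iso_tgt. Qed.

Lemma iso_src_subproof g : in_isotropy e (gsrc (val g)).
Proof. by rewrite /in_isotropy gsrc_src gtgt_src iso_src eqxx. Qed.

Lemma iso_mul_subproof g h : in_isotropy e (gmul (val g) (val h)).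
Proof.
rewrite /in_isotropy (gsrcM _ _ (iso_comp g h)) (gtgtM _ _ (iso_comp g h)).
by rewrite iso_src iso_tgt eqxx.
Qed.

Lemma iso_inv_subproof g : in_isotropy e (ginv (val g)).
Proof. by rewrite /in_isotropy gsrcV gtgtV iso_src iso_tgt eqxx. Qed.

Definition iso_unit g : isotropy e :=
  exist (in_isotropy e) _ (iso_src_subproof g).
Definition iso_mul g h : isotropy e :=
  exist (in_isotropy e) _ (iso_mul_subproof g h).
Definition iso_inv g : isotropy e :=
  exist (in_isotropy e) _ (iso_inv_subproof g).

Lemma iso_unitE g h : iso_unit g = iso_unit h.
Proof. by apply: val_inj; rewrite /= !iso_src. Qed.

Lemma iso_mulA g h k : iso_mul g (iso_mul h k) = iso_mul (iso_mul g h) k.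
Proof. by apply: val_inj; rewrite /= gmulA//; exact: iso_comp. Qed.

Lemma iso_mul_src g : iso_mul g (iso_unit g) = g.
Proof. by apply: val_inj; rewrite /= gmul_src. Qed.

Lemma iso_mul_tgt g : iso_mul (iso_unit g) g = g.
Proof. by apply: val_inj; rewrite /= (iso_comp g g) gmul_tgt. Qed.

Lemma iso_mulgV g : iso_mul g (iso_inv g) = iso_unit g.
Proof. by apply: val_inj; rewrite /= gmulgV (iso_comp g g). Qed.

Lemma iso_mulVg g : iso_mul (iso_inv g) g = iso_unit g.
Proof. by apply: val_inj; rewrite /= gmulVg. Qed.

HB.instance Definition _ := @isGroupoid.Build (isotropy e)
  iso_unit iso_unit iso_mul iso_inv
  (fun g => iso_unitE _ _) (fun g => iso_unitE _ _)
  (fun g => iso_unitE _ _) (fun g => iso_unitE _ _)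
  (fun g h _ => iso_unitE _ _) (fun g h _ => iso_unitE _ _)
  (fun g h k _ _ => iso_mulA g h k) iso_mul_src iso_mul_tgt
  (fun g => iso_unitE _ _) (fun g => iso_unitE _ _) iso_mulgV iso_mulVg.

End Isotropy.

(* [f] is only meaningful on [B]. *)
Definition ring_iso (R : naRingType) (B C : set R) (f : R -> R) : Prop :=
  [/\ set_bij B C f,
      forall x y, B x -> B y -> f (x + y) = f x + f y &
      forall x y, B x -> B y -> f (x ** y) = f x ** f y].

(* In [pa_dom_comp] and [pa_map_comp] the set
   [pa_dom (ginv h) `&` pa_map h @^-1` C] is the image of [C], a subset of
   [pa_dom h], under the inverse of the isomorphism [pa_map h]. *)
Record partial_action (G : groupoidType) (A : nuRingType) := PartialAction {
  pa_dom : G -> set A;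
  pa_map : G -> A -> A;
  pa_ideal_tgt : forall g, ideal (pa_dom (gtgt g));
  pa_ideal : forall g, ideal_in (pa_dom (gtgt g)) (pa_dom g);
  pa_iso : forall g, ring_iso (pa_dom (ginv g)) (pa_dom g) (pa_map g);
  pa_obj : forall e x, gobj e -> pa_dom e x -> pa_map e x = x;
  pa_dom_comp : forall g h, gsrc g = gtgt h ->
    pa_dom (ginv h) `&` pa_map h @^-1` (pa_dom (ginv g) `&` pa_dom h)
      `<=` pa_dom (ginv (gmul g h));
  pa_map_comp : forall g h x, gsrc g = gtgt h ->
    (pa_dom (ginv h) `&` pa_map h @^-1` (pa_dom (ginv g) `&` pa_dom h)) x ->
    pa_map g (pa_map h x) = pa_map (gmul g h) x
}.

(* The restriction [sigma^e].  The ambient ring is left to be [A] rather than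
   [A_e]; this does not affect the associated skew ring, whose elements only
   have coefficients in the ideals [A_h] of [A_e]. *)
Section Restriction.
Variables (G : groupoidType) (A : nuRingType) (sigma : partial_action G A).
Variable e : G.

Definition isotropy_action : partial_action (isotropy e) A.
Proof.
refine (@PartialAction (isotropy e) A
  (fun g => pa_dom sigma (val g)) (fun g => pa_map sigma (val g))
  _ _ _ _ _ _).
- by move=> g; rewrite /= (iso_comp g g); exact: pa_ideal_tgt.
- by move=> g; rewrite /= (iso_comp g g); exact: pa_ideal.
- by move=> g; exact: pa_iso.
- by move=> g x /(congr1 val) /= ge; exact: pa_obj.
- by move=> g h _; apply: pa_dom_comp; exact: iso_comp.
- by move=> g h x _; apply: pa_map_comp; exact: iso_comp.
Defined.

End Restriction.

Section SkewRing.
Variables (G : groupoidType) (A : nuRingType) (sigma : partial_action G A).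

Local Notation D := (pa_dom sigma).
Local Notation act := (pa_map sigma).

Definition formal_sum : set (G -> A) :=
  [set f | (forall g, D g (f g)) /\ finite_set [set g | f g != 0]].

Definition formal_sum_pred : {pred G -> A} := fun f => `[< formal_sum f >].

Lemma pa_dom0 g : D g 0.
Proof. by case: (pa_ideal sigma g). Qed.

Lemma pa_domB g x y : D g x -> D g y -> D g (x - y).
Proof. by case: (pa_ideal sigma g) => _ _ + _; apply. Qed.

Lemma pa_domD g x y : D g x -> D g y -> D g (x + y).
Proof.
move=> gx gy; rewrite -[y]opprK; apply: pa_domB => //.
by rewrite -sub0r; apply: pa_domB => //; exact: pa_dom0.
Qed.

Lemma formal_sum_closed : zmod_closed formal_sum_pred.
Proof.
split=> [|f f' /asboolP[Df finf] /asboolP[Df' finf']]; apply/asboolP; split.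
- by move=> g; exact: pa_dom0.
- apply: (@sub_finite_set _ _ set0) => [g /=|]; last exact: finite_set0.
  by rewrite eqxx.
- by move=> g; apply: pa_domB.
- apply: (@sub_finite_set _ _ ([set g | f g != 0] `|` [set g | f' g != 0])).
    move=> g /=; rewrite !fctE.
    have [->|] := eqVneq (f g) 0; last by left.
    by have [->|] := eqVneq (f' g) 0; [rewrite subr0 eqxx|right].
  by rewrite finite_setU.
Qed.

HB.instance Definition _ :=
  GRing.isZmodClosed.Build (G -> A) formal_sum_pred formal_sum_closed.

(* The element [\sum_g a_g \delta_g] is the function [g |-> a_g]. *)
Record skew_ring := SkewRing {
  skew_coef :> G -> A;
  skew_coefP : skew_coef \in formal_sum_pred
}.

HB.instance Definition _ := [isSub for skew_coef].
HB.instance Definition _ := [Choice of skew_ring by <:].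
HB.instance Definition _ := [SubChoice_isSubZmodule of skew_ring by <:].

Lemma skewP (x : skew_ring) : formal_sum x.
Proof. exact/asboolP/skew_coefP. Qed.

Lemma skewD (x y : skew_ring) g : (x + y) g = x g + y g.
Proof. by []. Qed.

Lemma act_additive g x y : D (ginv g) x -> D (ginv g) y ->
  act g (x + y) = act g x + act g y.
Proof. by case: (pa_iso sigma g) => _ + _; apply. Qed.

Lemma act0 g : act g 0 = 0.
Proof.
apply: (@addIr _ (act g 0)); rewrite -act_additive ?addr0 ?add0r//.
all: exact: pa_dom0.
Qed.

Lemma act_dom g x : D (ginv g) x -> D g (act g x).
Proof. by case: (pa_iso sigma g) => -[+ _ _] _ _; apply. Qed.

Lemma actV_dom g x : D g x -> D (ginv g) (act (ginv g) x).
Proof. by move=> gx; apply: act_dom; rewrite ginvK. Qed.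

Lemma actVK g x : D (ginv g) x -> act (ginv g) (act g x) = x.
Proof.
move=> gx; rewrite pa_map_comp ?gsrcV//.
  rewrite gmulVg pa_obj//; first exact: gsrc_src.
  by case: (pa_ideal sigma (ginv g)) => /(_ _ gx); rewrite gtgtV.
by split=> //=; rewrite ginvK; split; exact: act_dom.
Qed.

Lemma act_comp_dom g h x : gsrc g = gtgt h ->
  D (ginv g) x -> D h x -> D (gmul g h) (act g x).
Proof.
move=> gh gx hx.
have := @pa_dom_comp _ _ sigma (ginv h) (ginv g).
rewrite gsrcV gtgtV => /(_ (esym gh)); rewrite -ginvM// !ginvK; apply.
by split; [exact: act_dom|rewrite /= actVK].
Qed.

Lemma mid_dom g h a b : gsrc g = gtgt h -> D g a -> D h b ->
  D (ginv g) (act (ginv g) a ** b) /\ D h (act (ginv g) a ** b).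
Proof.
move=> gh /actV_dom ga hb.
have [sg _ _ ig] := pa_ideal sigma (ginv g).
have [sh _ _ ih] := pa_ideal sigma h.
move: ig sg; rewrite gtgtV gh => ig sg; split.
  by have [] := ig b (act (ginv g) a) (sh _ hb) ga.
by have [] := ih (act (ginv g) a) b (sg _ ga) hb.
Qed.

Definition hmul (g h : G) (a b : A) : A := act g (act (ginv g) a ** b).

Lemma hmul_dom g h a b : gsrc g = gtgt h -> D g a -> D h b ->
  D (gmul g h) (hmul g h a b).
Proof.
by move=> gh ga hb; have [? ?] := mid_dom gh ga hb; apply: act_comp_dom.
Qed.

Lemma hmul0l g h b : hmul g h 0 b = 0.
Proof. by rewrite /hmul act0 rmul0l act0. Qed.

Lemma hmul0r g h a : hmul g h a 0 = 0.
Proof. by rewrite /hmul rmul0 act0. Qed.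

Lemma hmulDl g h a a' b : gsrc g = gtgt h -> D g a -> D g a' -> D h b ->
  hmul g h (a + a') b = hmul g h a b + hmul g h a' b.
Proof.
move=> gh ga ga' hb; rewrite /hmul act_additive ?ginvK// rmulDl act_additive//.
  by case: (mid_dom gh ga hb).
by case: (mid_dom gh ga' hb).
Qed.

Lemma hmulDr g h a b b' : gsrc g = gtgt h -> D g a -> D h b -> D h b' ->
  hmul g h a (b + b') = hmul g h a b + hmul g h a b'.
Proof.
move=> gh ga hb hb'; rewrite /hmul rmulDr act_additive//.
  by case: (mid_dom gh ga hb).
by case: (mid_dom gh ga hb').
Qed.

Definition factorizations (k : G) : set (G * G) :=
  [set p | gsrc p.1 = gtgt p.2 /\ gmul p.1 p.2 = k].

Definition skew_mul_coef (x y : G -> A) (k : G) : A :=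
  \sum_(p \in factorizations k) hmul p.1 p.2 (x p.1) (y p.2).

Definition supp2 (x y : G -> A) : set (G * G) :=
  [set g | x g != 0] `*` [set h | y h != 0].

Lemma finite_supp2 (x y : skew_ring) : finite_set (supp2 x y).
Proof. by apply: finite_setX; [case: (skewP x)|case: (skewP y)]. Qed.

Lemma skew_mul_coefE (W : set (G * G)) (x y : G -> A) k :
  supp2 x y `<=` W -> skew_mul_coef x y k =
  \sum_(p \in factorizations k `&` W) hmul p.1 p.2 (x p.1) (y p.2).
Proof.
move=> sW; rewrite /skew_mul_coef; apply/esym/fsbig_widen; first by move=> ? [].
move=> [g h] [/= kp /not_andP[//|nW]].
have [->|xg] := eqVneq (x g) 0; first exact: hmul0l.
have [->|yh] := eqVneq (y h) 0; first exact: hmul0r.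
by case: nW; apply: sW.
Qed.

Lemma fsum_dom k (P : set (G * G)) (F : G * G -> A) :
  (forall p, P p -> D k (F p)) -> D k (\sum_(p \in P) F p).
Proof.
move=> PF; case: finite_supportP => [_|X XP _ _].
  by rewrite big_nil; exact: pa_dom0.
rewrite big_seq; elim/big_ind: _ => [|? ?|p /XP/PF//]; first exact: pa_dom0.
exact: pa_domD.
Qed.

Lemma skew_mul_subproof (x y : skew_ring) :
  skew_mul_coef x y \in formal_sum_pred.
Proof.
apply/asboolP; split=> [k|].
  apply: fsum_dom => -[g h] [/= gh <-].
  by apply: hmul_dom => //; [case: (skewP x)|case: (skewP y)].
apply: (@sub_finite_set _ _ ((fun p => gmul p.1 p.2) @` supp2 x y)); last first.
  by apply: finite_image; exact: finite_supp2.
move=> k /=; apply: contra_neqP => nk.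
rewrite (skew_mul_coefE _ (@subset_refl _ _)); apply: fsbig1 => p [[_ pk] Wp].
by case: nk; exists p.
Qed.

Definition skew_mul (x y : skew_ring) : skew_ring :=
  SkewRing (skew_mul_subproof x y).

Let sub_supp2 (x y x' y' : skew_ring) (W := (supp2 x y `|` supp2 x' y')) k :
  finite_set (factorizations k `&` W).
Proof.
apply: (@sub_finite_set _ _ W) => [? []//|].
by rewrite finite_setU; split; exact: finite_supp2.
Qed.

Lemma skew_mulDl : left_distributive skew_mul +%R.
Proof.
move=> x x' y; apply: val_inj; apply/funext => k /=.
set W := supp2 x y `|` supp2 x' y.
rewrite -[RHS]/(skew_mul_coef x y k + skew_mul_coef x' y k).
rewrite (@skew_mul_coefE W); last first.
  move=> [g h] [/=]; rewrite /W /supp2 /= -[(_ + _) g]/(x g + x' g).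
  have [->|? _] := eqVneq (x g) 0; last by left.
  by rewrite add0r; right.
rewrite (@skew_mul_coefE W x y); last by move=> ?; left.
rewrite (@skew_mul_coefE W x' y); last by move=> ?; right.
rewrite -fsbig_split; last exact: sub_supp2.
apply: eq_fsbigr => -[g h]; rewrite inE => -[[/= gh _] _].
by apply: hmulDl => //; [case: (skewP x)|case: (skewP x')|case: (skewP y)].
Qed.

Lemma skew_mulDr : right_distributive skew_mul +%R.
Proof.
move=> x y y'; apply: val_inj; apply/funext => k /=.
set W := supp2 x y `|` supp2 x y'.
rewrite -[RHS]/(skew_mul_coef x y k + skew_mul_coef x y' k).
rewrite (@skew_mul_coefE W); last first.
  move=> [g h] [/=]; rewrite /W /supp2 /= => xg.
  rewrite -[(_ + _) h]/(y h + y' h).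
  have [->|? _] := eqVneq (y h) 0; last by left.
  by rewrite add0r; right.
rewrite (@skew_mul_coefE W x y); last by move=> ?; left.
rewrite (@skew_mul_coefE W x y'); last by move=> ?; right.
rewrite -fsbig_split; last exact: sub_supp2.
apply: eq_fsbigr => -[g h]; rewrite inE => -[[/= gh _] _].
by apply: hmulDr => //; [case: (skewP x)|case: (skewP y)|case: (skewP y')].
Qed.

HB.instance Definition _ :=
  Zmodule_isNARing.Build skew_ring skew_mulDl skew_mulDr.

(* The homogeneous component [S_g = A_g \delta_g]. *)
Definition homog (g : G) : set skew_ring :=
  [set x | forall k, k != g -> x k = 0].

Definition graded_ideal (I : set skew_ring) : Prop :=
  ideal I /\ internal_direct_sum [set: G] (fun g => I `&` homog g) I.

Definition graded_prime : Prop := prime_for graded_ideal.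

Definition invariant_ideal (I : set A) : Prop :=
  ideal I /\ forall g, act g @` (I `&` D (ginv g)) `<=` I.

Definition G_prime : Prop := prime_for invariant_ideal.

Definition gobj_supp : set G := [set e | gobj e /\ D e <> [set 0]].

Definition support_hub (e : G) : Prop :=
  forall g x, homog g x -> x <> 0 -> exists h k,
    [/\ gsrc h = e, gtgt k = e, set_mul [set x] (homog h) <> [set 0] &
        set_mul (homog k) [set x] <> [set 0]].

End SkewRing.

(* Main.v *)
Require Import Defs.
From HB Require Import structures.
From mathcomp Require Import all_boot all_order all_algebra finmap.
From mathcomp Require Import boolp classical_sets functions cardinality fsbigop.

Set Implicit Arguments.
Unset Strict Implicit.
Unset Printing Implicit Defensive.

Import GRing.Theory.

Local Open Scope classical_set_scope.
Local Open Scope ring_scope.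

(** Write [S] for the skew ring and [C e] for the isotropy ring at [e], which
    [extend] embeds into [S] as the elements supported on the isotropy group.
    The theorem follows from four implications.

    - If some support-hub [e] has a prime [C e], then [S] is prime
      ([support_hub_prime]). Given a nonzero element of an ideal of [S], the hub
      property provides a monomial on the right and one on the left that move
      it into the corner [C e] while keeping one coefficient nonzero. So nonzero
      ideals of [S] restrict to nonzero ideals of [C e].
    - If [S] is prime, then so is each [C e] ([prime_corner]). For nonzero [u]
      and [v] in the corner some [u ** r ** v] is nonzero, and the part of [r]
      outside the corner does not contribute to it. This uses that [S] is
      associative ([skew_mulA]) and that no nonzero element is annihilated by
      multiplication on both sides ([skew_sandwich_neq0]); both follow from
      [s]-unitality.
    - If [S] is graded prime, then [A] is [G]-prime
      ([graded_prime_G_prime]), because an invariant ideal [I] of [A] gives the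
      graded ideal [I \rtimes G] of [S].
    - If [A] is [G]-prime, then each [e] in the support is a support-hub
      ([G_prime_support_hub]). After transport along [g], failure of the hub
      property at [a \delta_g] says that a nonzero element of [A] annihilates
      every [A_h] with source [e] from one side. Annihilators of invariant sets
      are invariant ideals, so an annihilator and its own annihilator on the
      other side contradict [G]-primeness.

    Since a prime ring is graded prime, each of the seven statements then gives
    primeness of [S], which gives all of them; that the support is nonempty
    turns statements about all objects into statements about some object. *)

(** * Primeness in terms of elements *)

Section PrimeElementwise.
Variable R : naRingType.
Implicit Types (x y z : R) (X Y I J : set R).

Lemma rmulBl x y z : (x - y) ** z = x ** z - y ** z.
Proof. by apply: (@addIr _ (y ** z)); rewrite -rmulDl !subrK. Qed.

Lemma rmulBr x y z : z ** (x - y) = z ** x - z ** y.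
Proof. by apply: (@addIr _ (z ** y)); rewrite -rmulDr !subrK. Qed.

Lemma set_mul_eq0 X Y :
  set_mul X Y = [set 0] <-> forall x y, X x -> Y y -> x ** y = 0.
Proof.
split=> [XY0 x y Xx Yy|XY0].
  suff : set_mul X Y (x ** y) by rewrite XY0.
  exists [:: (x, y)]; last by rewrite big_seq1.
  by move=> p; rewrite inE => /eqP ->.
apply/seteqP; split=> [z [s sXY ->]|z ->] /=; last first.
  by exists [::]; rewrite ?big_nil.
by rewrite big_seq big1// => p /sXY[]; exact: XY0.
Qed.

Lemma set_mul_neq0 X Y : set_mul X Y <> [set 0] ->
  exists x y, [/\ X x, Y y & x ** y <> 0].
Proof.
apply: contra_notP => nXY; apply/set_mul_eq0 => x y Xx Yy.
by apply: contra_notP nXY => xy0; exists x, y.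
Qed.

Lemma set_neq0 X : X 0 -> X <> [set 0] -> exists2 x, X x & x <> 0.
Proof.
move=> X0; apply: contra_notP => nX; apply/seteqP.
split=> [x Xx|x ->]//=; apply: contra_notP nX => x0; by exists x.
Qed.

Lemma neq_set0 X x : X x -> x <> 0 -> X <> [set 0].
Proof. by move=> + x0 X0; rewrite X0. Qed.

Lemma prime_forP (P : set R -> Prop) : (forall I, P I -> I 0) ->
  prime_for P <->
  forall I J x y, P I -> P J -> I x -> J y -> x <> 0 -> y <> 0 ->
    exists a b, [/\ I a, J b & a ** b <> 0].
Proof.
move=> P0; split=> [pP I J x y PI PJ Ix Jy x0 y0|pP [I [J [PI PJ I0 J0 IJ0]]]].
  apply: set_mul_neq0 => IJ0; apply: pP.
  by exists I, J; split=> //; [exact: neq_set0 x0|exact: neq_set0 y0].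
have [x Ix x0] := set_neq0 (P0 _ PI) I0.
have [y Jy y0] := set_neq0 (P0 _ PJ) J0.
have [a [b [Ia Jb]]] := pP I J x y PI PJ Ix Jy x0 y0; apply.
by move/set_mul_eq0: IJ0; apply.
Qed.

Lemma ideal0 I : ideal I -> I 0.
Proof. by case. Qed.

Lemma ideal_mulr I x y : ideal I -> I x -> I (x ** y).
Proof. by case=> _ _ _ id Ix; case: (id y x). Qed.

Lemma ideal_mull I x y : ideal I -> I x -> I (y ** x).
Proof. by case=> _ _ _ id Ix; case: (id y x). Qed.

Lemma ideal_add I x y : ideal I -> I x -> I y -> I (x + y).
Proof.
case=> _ I0 IB _ Ix Iy; rewrite -[y]opprK; apply: (IB) => //.
by rewrite -sub0r; exact: IB.
Qed.

Lemma prime_ringP : prime_ring R <->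
  forall I J x y, ideal I -> ideal J -> I x -> J y -> x <> 0 -> y <> 0 ->
    exists a b, [/\ I a, J b & a ** b <> 0].
Proof. by apply: prime_forP => I; exact: ideal0. Qed.

Definition subgroup X : Prop := X 0 /\ forall x y, X x -> X y -> X (x - y).

(** The set of finite sums of products [a ** x ** b], presented as the smallest
    subgroup containing these products: identities that are additive in an
    element of it then need only be checked on the products. *)
Definition sandwich x : set R :=
  [set z | forall X, subgroup X -> (forall a b, X (a ** x ** b)) -> X z].

Hypothesis rmulA : associative (@rmul R).

Lemma sandwich_ideal x : ideal (sandwich x).
Proof.
split=> // [X []//|u v xu xv X sX Xx|b u _ xu].
  by case: (sX) => _; apply; [exact: xu|exact: xv].
split=> X [X0 XB] Xx; [apply: (xu [set w | X (b ** w)])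
                      |apply: (xu [set w | X (w ** b)])].
- split=> [|v w Xv Xw] /=; first by rewrite rmul0.
  by rewrite rmulBr; exact: XB.
- by move=> a c /=; rewrite !rmulA.
- split=> [|v w Xv Xw] /=; first by rewrite rmul0l.
  by rewrite rmulBl; exact: XB.
- by move=> a c /=; rewrite -rmulA.
Qed.

(** The noncommutative substitute for the absence of zero divisors. The two
    hypotheses replace a unit: without them [R x R] could be zero. *)
Lemma prime_ring_middle x y : prime_ring R ->
  (exists a b, a ** x ** b <> 0) -> (exists a b, a ** y ** b <> 0) ->
  exists r, x ** r ** y <> 0.
Proof.
move=> /prime_ringP pR [a [b axb]] [c [d cyd]]; apply: contrapT => nr.
have xy0 r : x ** r ** y = 0 by apply: contra_notP nr => ?; exists r.
have [||u [v [xu yv]]] := pR _ _ _ _ (sandwich_ideal x) (sandwich_ideal y)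
  _ _ axb cyd; [by move=> X _; apply|by move=> X _; apply|apply].
apply: (xu [set w | w ** v = 0]) => [|a' b' /=].
  split=> [|s t /= s0 t0]; first exact: rmul0l.
  by rewrite rmulBl s0 t0 subr0.
apply: (yv [set w | a' ** x ** b' ** w = 0]) => [|c' d' /=].
  split=> [|s t /= s0 t0]; first exact: rmul0.
  by rewrite rmulBr s0 t0 subr0.
have -> : a' ** x ** b' ** (c' ** y ** d') = a' ** (x ** (b' ** c') ** y) ** d'.
  by rewrite !rmulA.
by rewrite xy0 rmul0 rmul0l.
Qed.

End PrimeElementwise.

Lemma fsbig_closed (V : nmodType) (T : choiceType) (P : V -> Prop) (X : set T)
    (f : T -> V) :
  P 0 -> (forall x y, P x -> P y -> P (x + y)) -> (forall t, X t -> P (f t)) ->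
  P (\sum_(t \in X) f t).
Proof.
move=> P0 PD Pf; case: finite_supportP => [_|Y YX _ _].
  by rewrite big_nil.
by rewrite big_seq; elim/big_ind: _ => // t /YX /Pf.
Qed.

(** * Monomials of a partial skew groupoid ring *)

Section Monomials.
Variables (G : groupoidType) (A : nuRingType) (sigma : partial_action G A).
Local Notation D := (pa_dom sigma).
Local Notation act := (pa_map sigma).
Local Notation S := (skew_ring sigma).
Implicit Types (g h k e : G) (a b c : A) (x y z : S).

Lemma mono_subproof g a :
  (fun k => if (k == g) && `[< D g a >] then a else 0)
    \in formal_sum_pred sigma.
Proof.
apply/asboolP; split=> [k|].
  by case: eqP => [->|_] /=; [case: asboolP => //|]; move=> *; exact: pa_dom0.
apply: (@sub_finite_set _ _ [set g]) => [k /=|]; last exact: finite_set1.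
by case: (k =P g) => //= _; rewrite eqxx.
Qed.

(** The monomial [a \delta_g]; the junk value [0] outside [D g] makes it a total
    function of [a]. *)
Definition mono g a : S := SkewRing (mono_subproof g a).

Lemma monoE g a k : D g a -> mono g a k = if k == g then a else 0.
Proof. by rewrite /mono /= => /asboolP ->; rewrite andbT. Qed.

Lemma mono_diag g a : D g a -> mono g a g = a.
Proof. by move=> ga; rewrite monoE// eqxx. Qed.

Lemma mono_homog g a : homog g (mono g a).
Proof. by move=> k /negbTE /= ->. Qed.

Lemma mono_neq0 g a : D g a -> a <> 0 -> mono g a <> 0.
Proof. by move=> ga a0 /(congr1 (fun x : S => x g)); rewrite mono_diag. Qed.

Lemma mono0 g : mono g 0 = 0.
Proof. by apply/val_inj/funext => k /=; case: ifP. Qed.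

Lemma skew_ext x y : (forall g, x g = y g) -> x = y.
Proof. by move=> xy; apply/val_inj/funext. Qed.

Lemma coefP x g : D g (x g).
Proof. by case: (skewP x). Qed.

Lemma homogE g x : homog g x -> x = mono g (x g).
Proof.
move=> hx; apply: skew_ext => k; rewrite monoE; last exact: coefP.
by case: eqVneq => [->//|/hx].
Qed.

Lemma skew_neq0 x : x <> 0 -> exists g, x g <> 0.
Proof.
apply: contra_notP => nx; apply: skew_ext => g.
by apply: contra_notP nx => ?; exists g.
Qed.

Lemma fsbig_coef (f : G -> S) k : finite_set [set g | f g != 0] ->
  (\sum_(g \in [set: G]) f g) k = \sum_(g \in [set: G]) f g k.
Proof.
move=> ff.
have sub : [set: G] `\` [set g | f g != 0] `<=` f @^-1` [set 0].
  by move=> g [_] /= /negP; rewrite negbK => /eqP.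
rewrite -(@fsbig_widen _ _ _ _ [set g | f g != 0])//.
rewrite -(@fsbig_widen _ _ _ _ [set g | f g != 0] _ (fun g => f g k))//; last first.
  by move=> g /sub /= ->.
rewrite !fsbig_finite//.
exact: (big_morph (fun x : S => x k) (fun _ _ => erefl) erefl).
Qed.

Lemma fsbig_coef_diag (f : G -> S) k : finite_set [set g | f g != 0] ->
  (forall g, homog g (f g)) -> (\sum_(g \in [set: G]) f g) k = f k k.
Proof.
move=> ff hf; rewrite fsbig_coef// -(@fsbig_widen _ _ _ _ [set k])//.
  by rewrite fsbig_set1.
by move=> g [_ /= gk]; apply: hf; apply/eqP => kg; apply: gk.
Qed.

Lemma finite_mono_supp x : finite_set [set g | mono g (x g) != 0].
Proof.
apply: (@sub_finite_set _ _ [set g | x g != 0]); last by case: (skewP x).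
by move=> g /=; apply: contra_neq => ->; exact: mono0.
Qed.

Lemma skew_sum x : x = \sum_(g \in [set: G]) mono g (x g).
Proof.
apply: skew_ext => k; rewrite fsbig_coef_diag;
  last by move=> g; exact: mono_homog.
  by rewrite mono_diag//; exact: coefP.
exact: finite_mono_supp.
Qed.

Lemma skew_ind (P : S -> Prop) : P 0 -> (forall x y, P x -> P y -> P (x + y)) ->
  (forall g a, D g a -> P (mono g a)) -> forall x, P x.
Proof.
move=> P0 PD Pm x; rewrite (skew_sum x); apply: fsbig_closed => // g _.
exact/Pm/coefP.
Qed.

Lemma mulr_mono x g h b : D h b -> gsrc g = gtgt h ->
  (x ** mono h b) (gmul g h) = hmul sigma g h (x g) b.
Proof.
move=> hb gh; rewrite /= (@skew_mul_coefE _ _ _ [set p | p.2 = h]).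
  have -> : factorizations (gmul g h) `&` [set p | p.2 = h] = [set (g, h)].
    apply/seteqP; split=> [[g' h'] [[/= gh' e] eh]|p -> //]; subst h'.
    by rewrite -(gmulK gh') e gmulK.
  by rewrite fsbig_set1 /=; case: asboolP => //; rewrite eqxx.
by move=> [g' h'] [/= _]; case: (h' =P h) => //=; rewrite eqxx.
Qed.

Lemma mulr_mono0 x h b k : gsrc k <> gsrc h -> (x ** mono h b) k = 0.
Proof.
move=> kh; apply: fsbig1 => -[g h'] [/= gh' e].
case: eqP => [eh|_] /=; last by rewrite hmul0r.
by case: kh; rewrite -e gsrcM// eh.
Qed.

Lemma mull_mono x g h b : D g b -> gsrc g = gtgt h ->
  (mono g b ** x) (gmul g h) = hmul sigma g h b (x h).
Proof.
move=> gb gh; rewrite /= (@skew_mul_coefE _ _ _ [set p | p.1 = g]).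
  have -> : factorizations (gmul g h) `&` [set p | p.1 = g] = [set (g, h)].
    apply/seteqP; split=> [[g' h'] [[/= gh' e] eg]|p -> //]; subst g'.
    by rewrite -(gmulKV gh') e gmulKV.
  by rewrite fsbig_set1 /=; case: asboolP => //; rewrite eqxx.
by move=> [g' h'] [/= + _]; case: (g' =P g) => //=; rewrite eqxx.
Qed.

Lemma mull_mono0 x g b k : gtgt k <> gtgt g -> (mono g b ** x) k = 0.
Proof.
move=> kg; apply: fsbig1 => -[g' h] [/= gh e].
case: eqP => [eg|_] /=; last by rewrite hmul0l.
by case: kg; rewrite -e gtgtM// eg.
Qed.

Lemma mono_mul g h a b : gsrc g = gtgt h -> D g a -> D h b ->
  mono g a ** mono h b = mono (gmul g h) (hmul sigma g h a b).
Proof.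
move=> gh ga hb; apply: skew_ext => k; rewrite monoE; last exact: hmul_dom.
have [->|kgh] := eqVneq; first by rewrite mulr_mono// mono_diag.
have [kh|/mulr_mono0->//] := pselect (gsrc k = gsrc h).
have e : gsrc (gmul k (ginv h)) = gtgt h by rewrite gsrcM ?gtgtV// gsrcV.
have ek : gmul (gmul k (ginv h)) h = k.
  by rewrite -gmulA ?gtgtV ?gsrcV// gmulVg -kh gmul_src.
rewrite -{1}ek mulr_mono// monoE// ifF ?hmul0l//.
by apply/eqP => eg; move: kgh; rewrite -eg ek eqxx.
Qed.

Lemma mono_mul0 g h a b : gsrc g <> gtgt h -> mono g a ** mono h b = 0.
Proof.
move=> gh; apply: skew_ext => k; apply: fsbig1 => -[g' h'] [/= gh' _].
have [eg|_] := eqVneq g' g; last by rewrite /= hmul0l.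
have [eh|_] := eqVneq h' h; last by rewrite /= hmul0r.
by case: gh; rewrite -eg -eh.
Qed.

End Monomials.
(** * Associativity *)

Section SUnital.
Variables (G : groupoidType) (A : nuRingType) (sigma : partial_action G A).
Hypothesis A_sunital : forall g : G, s_unital (pa_dom sigma g).
Local Notation D := (pa_dom sigma).
Local Notation act := (pa_map sigma).
Local Notation S := (skew_ring sigma).
Implicit Types (g h k e : G) (a b c : A) (x y z : S).

Lemma ginv_obj e : gobj e -> ginv e = e.
Proof.
move=> oe; have := gmul_src (ginv e).
by rewrite gsrcV (gobj_tgt oe) gmulVg oe.
Qed.

Lemma pa_dom_tgt g a : D g a -> D (gtgt g) a.
Proof. by case: (pa_ideal sigma g) => + _ _ _; apply. Qed.

Lemma pa_domV_src g a : D (ginv g) a -> D (gsrc g) a.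
Proof. by move=> /pa_dom_tgt; rewrite gtgtV. Qed.

Lemma act_mul g a b : D (ginv g) a -> D (ginv g) b ->
  act g (a ** b) = act g a ** act g b.
Proof. by case: (pa_iso sigma g) => _ _; apply. Qed.

Lemma actKV g a : D g a -> act g (act (ginv g) a) = a.
Proof. by move=> ga; rewrite -{1}(ginvK g) actVK// ginvK. Qed.

Lemma act_neq0 g a : D (ginv g) a -> a <> 0 -> act g a <> 0.
Proof. by move=> ga a0 e0; apply: a0; rewrite -(actVK ga) e0 act0. Qed.

Lemma act_comp g h a : gsrc g = gtgt h -> D (ginv h) a -> D (ginv g) (act h a) ->
  act g (act h a) = act (gmul g h) a.
Proof.
by move=> gh ha ga; apply: pa_map_comp => //; do !split=> //; exact: act_dom.
Qed.

(** Ideals of ideals need not be ideals; here a local unit of [D g] absorbs the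
    element of [A] into [D (gtgt g)]. *)
Lemma pa_dom_ideal g : ideal (D g).
Proof.
have [_ D0 DB Did] := pa_ideal sigma g; split=> // b a _ ga.
have [u [v [gu gv ua av]]] := A_sunital ga; split.
  rewrite -ua rmulA; case: (Did (b ** u) a) => //.
  exact: (ideal_mull _ (pa_ideal_tgt sigma g) (pa_dom_tgt gu)).
rewrite av -rmulA; case: (Did (v ** b) a) => //.
exact: (ideal_mulr _ (pa_ideal_tgt sigma g) (pa_dom_tgt gv)).
Qed.

(** On [D h] the multiplication by [c] transported along [h] commutes with
    multiplication by [a] on the left; this is where associativity could fail.
    A local unit [v] on the right of the second factor makes the
    transported multiplication a right multiplication by [act h (v ** c)]. *)
Lemma act_mulA h a b c : D h b ->
  act h (act (ginv h) (a ** b) ** c) = a ** act h (act (ginv h) b ** c).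
Proof.
move=> hb; have hV := actV_dom hb; have [_ [v [_ hv _ bv]]] := A_sunital hV.
have hab : D h (a ** b) := ideal_mull _ (pa_dom_ideal h) hb.
have hw := act_dom hv.
have bw : b = b ** act h v by rewrite -{2}(actKV hb) -act_mul// -bv actKV.
have abv : act (ginv h) (a ** b) = act (ginv h) (a ** b) ** v.
  by rewrite {1}bw rmulA (@act_mul _ (a ** b)) ?ginvK// actVK.
have hvc : D (ginv h) (v ** c) := ideal_mulr _ (pa_dom_ideal _) hv.
rewrite abv bv -!rmulA (act_mul (actV_dom hab) hvc) (act_mul hV hvc).
by rewrite !actKV// rmulA.
Qed.

(** Both sides are [act g] of the two sides of [act_mulA], the right one after
    [act (gmul g h)] has been split into [act g] and [act h]. *)
Lemma hmulA g h k a b c : gsrc g = gtgt h -> gsrc h = gtgt k ->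
  D g a -> D h b -> D k c ->
  hmul sigma g (gmul h k) a (hmul sigma h k b c) =
  hmul sigma (gmul g h) k (hmul sigma g h a b) c.
Proof.
move=> gh hk ga hb kc; rewrite /hmul.
set a' := act (ginv g) a; have ga' : D (ginv g) a' := actV_dom ga.
have [gu hu] := mid_dom gh ga hb; rewrite -/a' in gu hu.
have ghu : D (gmul g h) (act g (a' ** b)) := act_comp_dom gh gu hu.
rewrite (act_comp (g := ginv (gmul g h))) ?ginvK ?gsrcV ?gtgtM//.
have -> : gmul (ginv (gmul g h)) g = ginv h.
  by rewrite ginvM// -{2}(ginvK g) gmulK// gsrcV gtgtV.
have [hy _] := mid_dom hk hu kc.
rewrite -act_comp// act_mulA//.
exact: ideal_mulr (pa_dom_ideal _) ga'.
Qed.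

Lemma skew_mulA : associative (@rmul S).
Proof.
move=> x y z; move: x; apply: skew_ind => [|x x' Ix Ix'|g a ga].
- by rewrite !rmul0l.
- by rewrite !rmulDl Ix Ix'.
move: y; apply: skew_ind => [|y y' Iy Iy'|h b hb].
- by rewrite rmul0 !rmul0l rmul0.
- by rewrite rmulDl !rmulDr rmulDl Iy Iy'.
move: z; apply: skew_ind => [|z z' Iz Iz'|k c kc].
- by rewrite !rmul0.
- by rewrite !rmulDr Iz Iz'.
have [gh|gh] := pselect (gsrc g = gtgt h);
  have [hk|hk] := pselect (gsrc h = gtgt k).
- rewrite !mono_mul ?gsrcM ?gtgtM//; try exact: hmul_dom.
  by rewrite gmulA// hmulA.
- by rewrite (mono_mul0 _ _ _ hk) rmul0 mono_mul// mono_mul0// gsrcM.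
- by rewrite (mono_mul0 _ _ _ gh) rmul0l mono_mul// mono_mul0// gtgtM.
- by rewrite (mono_mul0 _ _ _ hk) (mono_mul0 _ _ _ gh) rmul0 rmul0l.
Qed.

(** Monomials at the two identity morphisms of [g] act as local units on the
    coefficient at [g]. *)
Lemma skew_sandwich_neq0 x : x <> 0 -> exists y z, y ** x ** z <> 0.
Proof.
move=> /skew_neq0[g xg0]; have gx := coefP x g.
have [u [_ [gu _ ux _]]] := A_sunital gx.
have [_ [v [_ gv _ xv]]] := A_sunital (actV_dom gx).
exists (mono sigma (gtgt g) u), (mono sigma (gsrc g) v).
have gs : gsrc g = gtgt (gsrc g) by rewrite gtgt_src.
have gt : gsrc (gtgt g) = gtgt g by rewrite gsrc_tgt.
have := mulr_mono (mono sigma (gtgt g) u ** x) (pa_domV_src gv) gs.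
have := mull_mono x (pa_dom_tgt gu) gt.
rewrite gmul_src gmul_tgt /hmul ginv_obj// !(@pa_obj _ _ _ (gtgt g)) ?ux//;
  try exact: pa_dom_tgt.
by move=> -> + x0; rewrite x0 -xv actKV// => /esym.
Qed.

End SUnital.

(** * Invariant ideals, graded ideals and support-hubs *)

Section GradedPrime.
Variables (G : groupoidType) (A : nuRingType) (sigma : partial_action G A).
Hypothesis A_sunital : forall g : G, s_unital (pa_dom sigma g).
Hypothesis A_sum : internal_direct_sum (@gobj G) (pa_dom sigma) [set: A].
Local Notation D := (pa_dom sigma).
Local Notation act := (pa_map sigma).
Local Notation S := (skew_ring sigma).
Implicit Types (g h k e : G) (a b c : A) (x y z : S) (I J K : set A).

Lemma object_dom_disjoint e f a : gobj e -> gobj f -> D e a -> D f a ->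
  a <> 0 -> e = f.
Proof.
move=> oe of_ ea fa; apply: contra_notP => ef.
have dec i : gobj i -> D i a ->
    is_sum_decomposition (@gobj G) D a (fun j => if j == i then a else 0).
  move=> oi ia; split=> [j _|j oj||].
  - by case: eqP => [->//|_]; exact: pa_dom0.
  - by case: eqP => // ji; case: oj; rewrite ji.
  - apply: (@sub_finite_set _ _ [set i]) => [j /=|]; last exact: finite_set1.
    by case: (j =P i) => //= _; rewrite eqxx.
  rewrite -(@fsbig_widen _ _ _ _ [set i]); first by rewrite fsbig_set1 eqxx.
    by move=> ? ->.
  by move=> j [_ /= /eqP /negbTE ->].
have [_ /(_ a _ _ (dec _ oe ea) (dec _ of_ fa))] := A_sum.
move=> /(congr1 (fun u => u e)).
by rewrite eqxx; case: eqP.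
Qed.

Lemma dom_tgt_eq g h a : D (gtgt g) a -> D (gtgt h) a -> a <> 0 ->
  gtgt g = gtgt h.
Proof. by apply: object_dom_disjoint; exact: gsrc_tgt. Qed.

(** Multiplying by a local unit of one nonzero component isolates it. *)
Lemma nonzero_component a : a <> 0 ->
  exists e u, [/\ gobj e, D e u & u ** a <> 0].
Proof.
move=> a0.
have [f [Df Df0 ff fa]] : exists f, is_sum_decomposition (@gobj G) D a f.
  by case: A_sum => AE _; have : [set: A] a by []; rewrite AE.
have [e fe0] : exists e, f e <> 0.
  apply: contra_notP a0 => nf; rewrite fa; apply: fsbig1 => i _.
  by apply: contra_notP nf => ?; exists i.
have oe : gobj e by apply: contra_notP fe0 => /Df0.
have [u [_ [eu _ uf _]]] := A_sunital (Df _ oe).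
exists e, u; split=> //.
(* [u] fixes the component [f e] and annihilates the other ones. *)
suff -> : u ** a = f e by [].
rewrite fa (@fsbig_widen _ _ _ _ _ setT)//; last by move=> i [_] /= /Df0.
rewrite -(@fsbig_widen _ _ _ _ [set i | f i != 0])//; last first.
  by move=> i [_] /= /negP; rewrite negbK => /eqP.
rewrite (fsbigD1 e)//=; last exact/eqP.
rewrite rmulDr uf -[RHS]addr0; congr (_ + _).
apply: (fsbig_closed (P := fun b => u ** b = 0)) => [|b c /= b0 c0|i [fi /= ie]].
- exact: rmul0.
- by rewrite rmulDr b0 c0 addr0.
have oi : gobj i by apply: contrapT => /Df0 /eqP; apply/negP.
apply: contra_notP ie => ufi; apply/esym/(object_dom_disjoint oe oi _ _ ufi).
- exact: (ideal_mulr _ (pa_dom_ideal A_sunital e)).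
- exact: (ideal_mull _ (pa_dom_ideal A_sunital i)) (Df _ oi).
Qed.

Lemma gobj_supp_exists : (exists a : A, a <> 0) -> exists e, gobj_supp sigma e.
Proof.
move=> [a /nonzero_component[e [u [oe eu ua]]]]; exists e; split=> //.
exact: neq_set0 (ideal_mulr a (pa_dom_ideal A_sunital e) eu) ua.
Qed.

(** The ideal [I \rtimes G] of the skew ring. *)
Definition skew_ideal I : set S := [set x | forall g, I (x g)].

Lemma invariant_act I g a : invariant_ideal sigma I -> I a -> D (ginv g) a ->
  I (act g a).
Proof. by case=> _ iI Ia ga; apply: (iI g); exists a. Qed.

Lemma skew_ideal_graded I : invariant_ideal sigma I -> graded_ideal (skew_ideal I).
Proof.
move=> iI; have idI := iI.1; have I0 := ideal0 idI.
split.
  split=> // [x y Ix Iy g|y x _ Ix]; first by case: idI => _ _ IB _;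
    exact: IB (Ix g) (Iy g).
  split=> k; apply: fsbig_closed => // [a b|[g h] [/= gh _]];
    try exact: ideal_add.
  - have [gD _] := mid_dom gh (coefP y g) (coefP x h).
    apply: invariant_act => //; exact: ideal_mull.
  - have [gD _] := mid_dom gh (coefP x g) (coefP y h).
    apply: invariant_act => //; apply: ideal_mulr => //.
    by apply: invariant_act => //; rewrite ginvK; exact: coefP.
have Imono x g : skew_ideal I x -> skew_ideal I (mono sigma g (x g)).
  by move=> Ix k; rewrite monoE; [case: eqP|exact: coefP].
split.
  apply/seteqP; split=> [x Ix|x [f [If _ _ ->]] g] /=.
    exists (fun g => mono sigma g (x g)); split=> //.
    - by move=> g _; split; [exact: Imono|exact: mono_homog].
    - by move=> g [].
    - exact: finite_mono_supp.
    - exact: skew_sum.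
  apply: (fsbig_closed (P := fun z : S => I (z g))) => // [y z|h _].
    exact: ideal_add.
  by case: (If h).
move=> x f f' [If _ ff xf] [If' _ ff' xf']; apply/funext => g.
have hf h : homog h (f h) by case: (If h).
have hf' h : homog h (f' h) by case: (If' h).
rewrite (homogE (hf g)) (homogE (hf' g)); congr mono.
by rewrite -(fsbig_coef_diag _ ff)// -(fsbig_coef_diag _ ff')// -xf -xf'.
Qed.

Lemma graded_prime_G_prime : graded_prime sigma -> G_prime sigma.
Proof.
move=> /prime_forP gp; apply/prime_forP => [I []|I J a b iI iJ Ia Jb a0 b0].
  by move=> /ideal0.
have mono_in K c : invariant_ideal sigma K -> K c -> c <> 0 ->
    exists2 x, skew_ideal K x & x <> 0.
  move=> [idK _] Kc /nonzero_component[e [u [oe eu uc]]].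
  have ec : D e (u ** c) := ideal_mulr c (pa_dom_ideal A_sunital e) eu.
  exists (mono sigma e (u ** c)); last exact: mono_neq0.
  move=> g; rewrite monoE//; case: eqP => _; first exact: ideal_mull.
  exact: ideal0.
have [x Ix x0] := mono_in _ _ iI Ia a0; have [y Jy y0] := mono_in _ _ iJ Jb b0.
have [|z [w [Iz Jw zw]]] := gp _ _ _ x y (skew_ideal_graded iI)
  (skew_ideal_graded iJ) Ix Jy x0 y0; first by move=> K [/ideal0].
have [k zwk] := skew_neq0 zw.
apply: contrapT => nIJ; apply: zwk; apply: fsbig1 => -[g h] [/= gh _].
rewrite /hmul; suff -> : act (ginv g) (z g) ** w h = 0 by rewrite act0.
apply: contra_notP nIJ => zw0; exists (act (ginv g) (z g)), (w h); split=> //.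
by apply: invariant_act; rewrite ?ginvK//; exact: coefP.
Qed.

Definition lann K : set A := [set a | forall b, K b -> a ** b = 0].
Definition rann K : set A := [set a | forall b, K b -> b ** a = 0].

(** An invariant ideal up to closure under addition. Annihilators do not see
    the difference, so no sum of ideals has to be formed. *)
Definition invariant_absorbing K : Prop :=
  (forall a b, K a -> K (a ** b) /\ K (b ** a)) /\
  (forall g a, K a -> D (ginv g) a -> K (act g a)).

Lemma invariant_absorbing_ideal K : invariant_ideal sigma K -> invariant_absorbing K.
Proof.
move=> iK; split=> [a b Ka|g a Ka ga]; last exact: invariant_act.
by case: iK => iK _; split; [exact: ideal_mulr|exact: ideal_mull].
Qed.

(** For invariance, a factor outside [act g] is moved inside after a local unit
    of [D g] has brought it into [D g]. *)
Lemma lann_invariant K : invariant_absorbing K -> invariant_ideal sigma (lann K).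
Proof.
move=> [Kid Kact]; split.
  split=> // [b _|a a' Ka Ka' b Kb|b a _ Ka]; first exact: rmul0l.
    by rewrite rmulBl Ka// Ka'// subr0.
  split=> c Kc; rewrite -rmulA; first by rewrite Ka// rmul0.
  by apply: Ka; case: (Kid c b Kc).
move=> g _ [a [Ka ga] <-] b Kb; have aD := act_dom ga.
have [_ [v [_ gv _ ->]]] := A_sunital aD; rewrite -rmulA.
have vb : D g (v ** b) := ideal_mulr b (pa_dom_ideal A_sunital g) gv.
rewrite -(actKV vb) -act_mul//; last exact: actV_dom.
rewrite Ka ?act0//; apply: Kact; rewrite ?ginvK//.
by case: (Kid b v Kb).
Qed.

Lemma rann_invariant K : invariant_absorbing K -> invariant_ideal sigma (rann K).
Proof.
move=> [Kid Kact]; split.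
  split=> // [b _|a a' Ka Ka' b Kb|b a _ Ka]; first exact: rmul0.
    by rewrite rmulBr Ka// Ka'// subr0.
  split=> c Kc; rewrite rmulA; last by rewrite Ka// rmul0l.
  by apply: Ka; case: (Kid c b Kc).
move=> g _ [a [Ka ga] <-] b Kb; have aD := act_dom ga.
have [v [_ [gv _ <- _]]] := A_sunital aD; rewrite rmulA.
have bv : D g (b ** v) := ideal_mull b (pa_dom_ideal A_sunital g) gv.
rewrite -(actKV bv) -act_mul//; last exact: actV_dom.
rewrite Ka ?act0//; apply: Kact; rewrite ?ginvK//.
by case: (Kid b v Kb).
Qed.

(** The right annihilator of [lann K] contains [K], hence is nonzero, so that
    [lann K] must be zero; symmetrically for [rann K]. *)
Lemma G_prime_no_annihilator K b : G_prime sigma -> invariant_absorbing K ->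
  K b -> b <> 0 -> forall a, a <> 0 ->
  (exists2 c, K c & a ** c <> 0) /\ (exists2 c, K c & c ** a <> 0).
Proof.
move=> gp iK Kb b0 a a0.
have inv0 I : invariant_ideal sigma I -> I 0 by move=> [/ideal0].
have /(prime_forP inv0) {}gp := gp.
have il := lann_invariant iK; have ir := rann_invariant iK.
split; apply: contrapT => nK.
- have la : lann K a by move=> c Kc; apply: contra_notP nK => ?; exists c.
  have rb : rann (lann K) b by move=> c; apply.
  have irl := rann_invariant (invariant_absorbing_ideal il).
  have [c [d [lc rd]]] := gp _ _ _ _ il irl la rb a0 b0.
  by apply; exact: rd.
- have ra : rann K a by move=> c Kc; apply: contra_notP nK => ?; exists c.
  have lb : lann (rann K) b by move=> c; apply.
  have ilr := lann_invariant (invariant_absorbing_ideal ir).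
  have [c [d [lc rd]]] := gp _ _ _ _ ilr ir lb ra b0 a0.
  by apply; exact: lc.
Qed.

(** Its additive span is the invariant ideal generated by [D e]. *)
Definition transported e : set A := [set a | exists2 h, gsrc h = e & D h a].

Lemma transported_invariant e : gobj e -> invariant_absorbing (transported e).
Proof.
move=> oe; split=> [a b [h he ha]|g a [h he ha] ga].
  by split; exists h => //; [apply: ideal_mulr|apply: ideal_mull];
    do ?exact: pa_dom_ideal.
have [->|a0] := pselect (a = 0).
  by rewrite act0; exists e => //; exact: pa_dom0.
have gh : gsrc g = gtgt h.
  rewrite -(gtgtV g); apply: dom_tgt_eq a0; exact: pa_dom_tgt.
by exists (gmul g h); [rewrite gsrcM|exact: act_comp_dom].
Qed.

(** Multiplying [a \delta_g] on the right by [c \delta_h] amounts to multiplying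
    the transported coefficient [act (ginv g) a] by [c]. On the left one uses
    [\delta_(ginv k)] with [k] of source [e], which amounts to multiplying [a] by
    an element of [D k]. In both cases a nonzero product in [A] forces the
    morphisms to be composable, the summands of [A] being orthogonal. *)
Lemma G_prime_support_hub e : G_prime sigma -> gobj_supp sigma e ->
  support_hub sigma e.
Proof.
move=> gp [oe De0] g x hx x0.
have [b eb b0] := set_neq0 (pa_dom0 sigma e) De0.
have Kb : transported e b by exists e.
have noann := G_prime_no_annihilator gp (transported_invariant oe) Kb b0.
set a := x g; have ga : D g a := coefP x g.
have a0 : a <> 0 by move=> a0; apply: x0; rewrite (homogE hx) -/a a0 mono0.
have ga' := actV_dom ga.
have a'0 : act (ginv g) a <> 0 by apply: act_neq0 => //; rewrite ginvK.
have [[c [h he hc] ac] _] := noann _ a'0.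
have [_ [d [k ke kd] da]] := noann _ a0.
have gh : gsrc g = gtgt h.
  rewrite -(gtgtV g); apply: dom_tgt_eq ac.
    exact: pa_dom_tgt (ideal_mulr _ (pa_dom_ideal A_sunital _) ga').
  exact: pa_dom_tgt (ideal_mull _ (pa_dom_ideal A_sunital _) hc).
have kg : gtgt k = gtgt g.
  apply: dom_tgt_eq da.
    exact: pa_dom_tgt (ideal_mulr _ (pa_dom_ideal A_sunital _) kd).
  exact: pa_dom_tgt (ideal_mull _ (pa_dom_ideal A_sunital _) ga).
exists h, (ginv k); split=> //; first by rewrite gtgtV.
- move=> /set_mul_eq0/(_ x (mono sigma h c) erefl (@mono_homog _ _ _ _ _)).
  move=> /(congr1 (fun x : S => x (gmul g h))).
  rewrite mulr_mono//; apply: act_neq0 => //.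
  exact: (ideal_mulr _ (pa_dom_ideal A_sunital _) ga').
- have kd' := actV_dom kd; have kg' : gsrc (ginv k) = gtgt g by rewrite gsrcV.
  move=> /set_mul_eq0/(_ (mono sigma _ (act (ginv k) d)) x
    (@mono_homog _ _ _ _ _) erefl).
  move=> /(congr1 (fun x : S => x (gmul (ginv k) g))).
  rewrite mull_mono// /hmul ginvK actKV//; apply: act_neq0 => //.
  by rewrite ginvK; exact: (ideal_mulr _ (pa_dom_ideal A_sunital _) kd).
Qed.

End GradedPrime.

(** * The isotropy rings as corners *)

Section Corner.
Variables (G : groupoidType) (A : nuRingType) (sigma : partial_action G A).
Variable e : G.
Local Notation D := (pa_dom sigma).
Local Notation act := (pa_map sigma).
Local Notation S := (skew_ring sigma).
Local Notation C := (skew_ring (isotropy_action sigma e)).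
Implicit Types (g h k : G) (a b c : A) (x y z : S) (u v w : C).

Lemma isotropy_val g : in_isotropy e g -> exists h : isotropy e, g = val h.
Proof. by move=> ge; exists (exist _ g ge). Qed.

Definition extend_coef (w : C) g : A :=
  oapp (fun h : isotropy e => w h) 0 (insub g).

Lemma extend_coef_val w (h : isotropy e) : extend_coef w (val h) = w h.
Proof. by rewrite /extend_coef valK. Qed.

Lemma extend_coef_out w g : ~~ in_isotropy e g -> extend_coef w g = 0.
Proof. by move=> ng; rewrite /extend_coef insubN. Qed.

Lemma extend_subproof w : extend_coef w \in formal_sum_pred sigma.
Proof.
apply/asboolP; split=> [g|].
  have [/isotropy_val[h ->]|ng] := boolP (in_isotropy e g).
    rewrite extend_coef_val; exact: (coefP w).
  by rewrite extend_coef_out//; exact: pa_dom0.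
apply: (@sub_finite_set _ _ (val @` [set h : isotropy e | w h != 0])).
  move=> g /=; have [/isotropy_val[h ->]|ng] := boolP (in_isotropy e g).
    by rewrite extend_coef_val; exists h.
  by rewrite extend_coef_out// eqxx.
by apply: finite_image; case: (skewP w).
Qed.

(** Extension by zero, an injective ring morphism onto the elements supported
    on the isotropy group. *)
Definition extend w : S := SkewRing (extend_subproof w).

Lemma extend_val w (h : isotropy e) : extend w (val h) = w h.
Proof. exact: extend_coef_val. Qed.

Lemma extend_inj : injective extend.
Proof. by move=> u v uv; apply: skew_ext => h; rewrite -!extend_val uv. Qed.

Lemma extend_ext w x : (forall h : isotropy e, w h = x (val h)) ->
  (forall g, ~~ in_isotropy e g -> x g = 0) -> extend w = x.
Proof.
move=> wx x0; apply: skew_ext => g.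
have [/isotropy_val[h ->]|ng] := boolP (in_isotropy e g).
  by rewrite extend_val wx.
by rewrite x0//; exact: extend_coef_out.
Qed.

Lemma extend0 : extend 0 = 0.
Proof. exact: extend_ext. Qed.

Lemma extendD u v : extend (u + v) = extend u + extend v.
Proof.
apply: extend_ext => [h|g ng]; first by rewrite !skewD !extend_val.
by rewrite skewD /= !extend_coef_out// addr0.
Qed.

Lemma extendB u v : extend (u - v) = extend u - extend v.
Proof. by apply: (@addIr _ (extend v)); rewrite -extendD !subrK. Qed.

Lemma extend_mono (h : isotropy e) a : D (val h) a ->
  extend (mono (isotropy_action sigma e) h a) = mono sigma (val h) a.
Proof.
move=> ha; apply: extend_ext => [k|g ng]; first by rewrite !monoE// val_eqE.
rewrite monoE//; case: eqP => // gh.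
by move: ng; rewrite gh (valP h).
Qed.

Lemma extendM u v : extend (u ** v) = extend u ** extend v.
Proof.
move: u; apply: skew_ind => [|u u' Iu Iu'|g a ga].
- by rewrite extend0 !rmul0l extend0.
- by rewrite rmulDl !extendD rmulDl Iu Iu'.
move: v; apply: skew_ind => [|v v' Iv Iv'|h b hb].
- by rewrite extend0 !rmul0 extend0.
- by rewrite rmulDr !extendD rmulDr Iv Iv'.
have gh := iso_comp g h.
rewrite !extend_mono// !mono_mul//; last exact: iso_unitE.
by rewrite extend_mono//; exact: (hmul_dom gh).
Qed.

Lemma extend_surj x : (forall g, ~~ in_isotropy e g -> x g = 0) ->
  exists w, extend w = x.
Proof.
move=> x0.
have wP : (fun h : isotropy e => x (val h))
    \in formal_sum_pred (isotropy_action sigma e).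
  apply/asboolP; split=> [h|]; first exact: coefP.
  apply: (@finite_preimage _ _ [set g | x g != 0] val); last by case: (skewP x).
  by move=> ? ? _ _; exact: val_inj.
by exists (SkewRing wP); exact: extend_ext.
Qed.

Lemma preimage_extend_ideal (I : set S) : ideal I -> ideal (extend @^-1` I).
Proof.
move=> idI; split=> // [|u v Iu Iv|u v _ Iv] /=.
- by rewrite extend0; exact: ideal0.
- by rewrite extendB; case: idI => _ _ IB _; exact: IB.
by rewrite !extendM; split; [exact: ideal_mull|exact: ideal_mulr].
Qed.

(** A hub lets one push a nonzero coefficient of an element of the ideal into
    the corner: a factor on the right brings all sources to [e], then one on the
    left brings all ranges to [e]. *)
Lemma support_hub_corner (I : set S) x : support_hub sigma e -> ideal I -> I x ->
  x <> 0 -> exists2 w, I (extend w) & w <> 0.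
Proof.
move=> hub idI Ix /skew_neq0[g xg0]; have gx := coefP x g.
have [h [_ [he _ /set_mul_neq0[_ [s [-> hs gs0]]] _]]] :=
  hub g _ (@mono_homog _ _ _ g _) (mono_neq0 gx xg0).
rewrite (homogE hs) in gs0; set b := s h in gs0; have hb : D h b := coefP s h.
have gh : gsrc g = gtgt h.
  by apply: contra_notP gs0 => gh; rewrite mono_mul0.
set y := x ** mono sigma h b.
have y0 : y (gmul g h) <> 0.
  rewrite mulr_mono//; apply: contra_not gs0 => xb0.
  by rewrite mono_mul// xb0 mono0.
have ysrc l : gsrc l <> e -> y l = 0.
  by move=> le; apply: mulr_mono0; rewrite he.
have Iy : I y by exact: ideal_mulr.
have yD := coefP y (gmul g h).
have [_ [k [_ ke _ /set_mul_neq0[t [_ [kt -> tg0]]]]]] :=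
  hub _ _ (@mono_homog _ _ _ _ _) (mono_neq0 yD y0).
rewrite (homogE kt) in tg0; set c := t k in tg0; have kc : D k c := coefP t k.
have kgh : gsrc k = gtgt (gmul g h).
  by apply: contra_notP tg0 => kg; rewrite mono_mul0.
set z := mono sigma k c ** y.
have z0 : z (gmul k (gmul g h)) <> 0.
  rewrite mull_mono//; apply: contra_not tg0 => cy0.
  by rewrite mono_mul// cy0 mono0.
have [l nl|w wz] := @extend_surj z.
  have [/eqP lt|lt] := boolP (gtgt l == e); last first.
    by apply: mull_mono0; rewrite ke; exact/eqP.
  have ls : gsrc l <> e.
    by move=> ls; move: nl; rewrite /in_isotropy ls lt eqxx.
  apply: fsbig1 => -[k' l'] [/= kl e'].
  have yl0 : y l' = 0 by apply: ysrc => l'e; apply: ls; rewrite -e' gsrcM.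
  exact: etrans (congr1 (hmul sigma k' l' (mono sigma k c k')) yl0)
                (hmul0r _ _ _ _).
exists w; first by rewrite wz; exact: ideal_mull.
by move=> w0; apply: z0; rewrite -wz w0 extend0.
Qed.

(** Nonzero ideals [I], [J] of the whole ring meet the corner in nonzero
    ideals. *)
Lemma support_hub_prime : support_hub sigma e -> prime_ring C -> prime_ring S.
Proof.
move=> hub /prime_ringP pC; apply/prime_ringP => I J x y idI idJ Ix Jy x0 y0.
have [u Iu u0] := support_hub_corner hub idI Ix x0.
have [v Jv v0] := support_hub_corner hub idJ Jy y0.
have [a [b [Ia Jb ab0]]] := pC _ _ _ _ (preimage_extend_ideal idI)
  (preimage_extend_ideal idJ) Iu Jv u0 v0.
exists (extend a), (extend b); split=> //.
by rewrite -extendM -extend0 => /extend_inj.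
Qed.

Lemma extend_mul_mono0 w k c : gtgt k <> e -> extend w ** mono sigma k c = 0.
Proof.
move=> ke; move: w; apply: skew_ind => [|u v Iu Iv|h a ha].
- by rewrite extend0 rmul0l.
- by rewrite extendD rmulDl Iu Iv addr0.
by rewrite extend_mono// mono_mul0// iso_src; apply/nesym.
Qed.

Lemma mono_mul_extend0 w k c : gsrc k <> e -> mono sigma k c ** extend w = 0.
Proof.
move=> ke; move: w; apply: skew_ind => [|u v Iu Iv|h a ha].
- by rewrite extend0 rmul0.
- by rewrite extendD rmulDr Iu Iv addr0.
by rewrite extend_mono// mono_mul0// iso_tgt.
Qed.

Hypothesis A_sunital : forall g : G, s_unital (D g).

(** In a prime ring [u ** r ** v] is nonzero for some [r]; between two elements
    of the corner only the part of [r] in the corner survives. *)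
Lemma prime_corner : prime_ring S -> prime_ring C.
Proof.
move=> pS; apply/prime_ringP => I J u v idI idJ Iu Jv u0 v0.
have ext_neq0 w : w <> 0 -> extend w <> 0.
  by move=> w0; rewrite -extend0 => /extend_inj.
have [r uv0] := prime_ring_middle (skew_mulA A_sunital) pS
  (skew_sandwich_neq0 A_sunital (ext_neq0 _ u0))
  (skew_sandwich_neq0 A_sunital (ext_neq0 _ v0)).
apply: contrapT => nIJ; apply: uv0; move: r.
apply: skew_ind => [|x y Ix Iy|k c kc].
- by rewrite rmul0 rmul0l.
- by rewrite rmulDr rmulDl Ix Iy addr0.
have [kt|kt] := pselect (gtgt k = e); last first.
  by rewrite extend_mul_mono0// rmul0l.
have [ks|ks] := pselect (gsrc k = e); last first.
  by rewrite -(skew_mulA A_sunital) mono_mul_extend0// rmul0.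
have ke : in_isotropy e k by rewrite /in_isotropy ks kt eqxx.
have [h kh] := isotropy_val ke; rewrite kh in kc *.
rewrite -extend_mono// -!extendM -[RHS]extend0; congr extend.
apply: contra_notP nIJ => uv0.
exists (u ** mono (isotropy_action sigma e) h c), v; split=> //.
exact: ideal_mulr.
Qed.

End Corner.

(** * The equivalence *)

Theorem theorem4p9 (G : groupoidType) (A : nuRingType)
    (sigma : partial_action G A)
    (A_neq0 : exists a : A, a <> 0)
    (A_sunital : forall g : G, s_unital (pa_dom sigma g))
    (A_sum : internal_direct_sum (@gobj G) (pa_dom sigma) [set: A]) :
  [<-> prime_ring (skew_ring sigma);
       G_prime sigma /\
         (forall e, gobj_supp sigma e ->
            prime_ring (skew_ring (isotropy_action sigma e)));
       G_prime sigma /\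
         (exists e, gobj_supp sigma e /\
            prime_ring (skew_ring (isotropy_action sigma e)));
       graded_prime sigma /\
         (forall e, gobj_supp sigma e ->
            prime_ring (skew_ring (isotropy_action sigma e)));
       graded_prime sigma /\
         (exists e, gobj_supp sigma e /\
            prime_ring (skew_ring (isotropy_action sigma e)));
       forall e, gobj_supp sigma e ->
         support_hub sigma e /\
         prime_ring (skew_ring (isotropy_action sigma e));
       exists e, [/\ gobj_supp sigma e, support_hub sigma e &
         prime_ring (skew_ring (isotropy_action sigma e))]].
Proof.
have [e0 supp0] := gobj_supp_exists A_sunital A_sum A_neq0.
have graded : prime_ring (skew_ring sigma) -> graded_prime sigma.
  apply: contra_not => -[I [J [[idI _] [idJ _] I0 J0 IJ]]].
  by exists I, J.
have Gprime := graded_prime_G_prime A_sunital A_sum.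
have hub e := @G_prime_support_hub _ _ _ A_sunital A_sum e.
have corner e : prime_ring (skew_ring sigma) ->
    prime_ring (skew_ring (isotropy_action sigma e)) := prime_corner A_sunital.
have whole : G_prime sigma -> (exists e, gobj_supp sigma e /\
    prime_ring (skew_ring (isotropy_action sigma e))) ->
    prime_ring (skew_ring sigma).
  by move=> gp [e [se pe]]; exact: support_hub_prime (hub e gp se) pe.
tfae.
- by move=> pS; split=> [|e _]; [exact/Gprime/graded|exact: corner].
- by move=> [gp pe]; split=> //; exists e0; split=> //; exact: pe.
- move=> [gp ex]; have pS := whole gp ex.
  by split=> [|e _]; [exact: graded|exact: corner].
- by move=> [gp pe]; split=> //; exists e0; split=> //; exact: pe.
- move=> [/Gprime gp ex] e se; split; first exact: hub.
  exact/corner/whole.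
- by move=> all; exists e0; have [] := all _ supp0.
- by move=> [e [_ he pe]]; exact: support_hub_prime he pe.
Qed.
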